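(* Let $x^*\in\mathcal M$ be an index-$k$ saddle point and let $\delta>0$, $L>\mu>0$ be such that for every $x\in\mathcal M$ with $d(x,x^* )<\delta$ the eigenvalues of $\operatorname{Hess}f(x)$ satisfy $$-L\le\lambda_1\le\cdots\le\lambda_k\le-\mu<0<\mu\le\lambda_{k+1}\le\cdots\le\lambda_{d-m}\le L ,$$ and put $\kappa=L/\mu$. Choose $$\Delta t=\frac{4}{(\sqrt L+\sqrt\mu)^2},\qquad \gamma=\Big(\frac{\sqrt L-\sqrt\mu}{\sqrt L+\sqrt\mu}\Big)^2 .$$ Consider the discrete momentum-based constrained saddle dynamics started from $x_0\in\mathcal M$ and $r_0=0\in T_{x_0}\mathcal M$: $$\bar r_n=-\Delta t\Big(I-2\sum_{i=1}^kv_{i,n}v_{i,n}^\top\Big)\operatorname{grad}f(x_n)+\gamma r_n,\qquad x_{n+1}=\exp_{x_n}(\bar r_n),\qquad r_{n+1}=P_{x_n\to x_{n+1}}\bar r_n,$$ where $v_{1,n},\dots,v_{k,n}$ are exact orthonormal eigenvectors of $\operatorname{Hess}f(x_n)$ for its $k$ smallest eigenvalues. Then the iterates converge locally to $x^*$ with a linear rate depending on $\sqrt\kappa$. Precisely: let $C_0\ge1$, $C>0$, $r^*>0$ be the constants described in the context, and fix $C_h>2C_0$. If the initial condition satisfies $$\|\zeta_0\|\le\min\Big(\frac{\sqrt\kappa}{(1+\sqrt\kappa)^2\,C\,C_h^2},\ \frac{r^*}{C_h}\Big),$$ then for all $n\ge0$ $$\|\zeta_n\|\le\left\|\begin{pmatrix}\zeta_n\\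 \rho_n\end{pmatrix}\right\|\le C_h\Big(1-\frac1{1+\sqrt\kappa}\Big)^n\left\|\begin{pmatrix}\zeta_0\\ \rho_0\end{pmatrix}\right\| .$$
   Context: Let $f:\mathbb{R}^d\to\mathbb{R}$ and $c_1,\dots,c_m:\mathbb{R}^d\to\mathbb{R}$ be smooth, $\mathcal M=\{x\in\mathbb{R}^d:c_1(x)=\dots=c_m(x)=0\}$, with $\nabla c_1(x),\dots,\nabla c_m(x)$ linearly independent for every $x\in\mathcal M$. $\mathcal M$ carries the Riemannian metric induced from $\mathbb{R}^d$, with geodesic distance $d(\cdot,\cdot)$, exponential map $\exp$, and Riemannian gradient and Hessian $\operatorname{grad}f$, $\operatorname{Hess}f$. $P_{x\to y}$ denotes parallel transport from $T_x\mathcal M$ to $T_y\mathcal M$ along the (short) geodesic from $x$ to $y$. An index-$k$ saddle point is a point with $\operatorname{grad}f(x^* )=0$ such that $\operatorname{Hess}f(x^* )$ has exactly $k$ negative eigenvalues; $1\le k\le d-m-1$. Local coordinates near $x^*$: $\zeta_n=\exp_{x^*}^{-1}(x_n)\in T_{x^*}\mathcal M$ and $\rho_n=P_{x_n\to x^*}r_n\in T_{x^*}\mathcal M$. Norms are Euclidean, with $\big\|\binom{\zeta}{\rho}\big\|=\sqrt{\|\zeta\|^2+\|\rho\|^2}$. Let $H^*=\operatorname{Hess}f(x^* )$, $R^*=I-2\sum_{i=1}^kv_i^*(v_i^* )^\top$ with $v_1^*,\dots,v_k^*$ orthonormal eigenvectors of $H^*$ for its $k$ negative eigenvalues, and $$A=\begin{pmatrix}I-\Delta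 tR^*H^*&\gamma I\\-\Delta tR^*H^*&\gamma I\end{pmatrix}\quad\text{on }T_{x^*}\mathcal M\oplus T_{x^*}\mathcal M .$$ Constants: - $C_0\ge1$ is such that $\|A^n\|\le C_0\big(1-\frac{1}{1+\sqrt\kappa}\big)^n$ for all $n\ge1$ (operator norm). - $r^*>0$ and $C>0$ are such that whenever $\big\|\binom{\zeta_n}{\rho_n}\big\|<r^*$, the local coordinates $(\zeta_{n+1},\rho_{n+1})$ of the next iterate are well defined and $$\binom{\zeta_{n+1}}{\rho_{n+1}}=A\binom{\zeta_n}{\rho_n}+res_n,\qquad\|res_n\|\le C(\|\zeta_n\|^2+\|\rho_n\|^2).$$ Such constants exist for the choice $\Delta t=\frac{4}{(\sqrt L+\sqrt\mu)^2}$, $\gamma=\Big(\frac{\sqrt L-\sqrt\mu}{\sqrt L+\sqrt\mu}\Big)^2$, where $L>\mu>0$ are such that, for some $\delta>0$ and every $x\in\mathcal M$ with $d(x,x^* )<\delta$, the eigenvalues of $\operatorname{Hess}f(x)$ satisfy $-L\le\lambda_1\le\cdots\le\lambda_k\le-\mu<0<\mu\le\lambda_{k+1}\le\cdots\le\lambda_{d-m}\le L$, and $\kappa=L/\mu$. *)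

(* Defs.v *)
From HB Require Import structures.
From mathcomp Require Import all_boot all_order all_algebra.
From mathcomp Require Import all_classical all_reals all_analysis.

Set Implicit Arguments.
Unset Strict Implicit.
Unset Printing Implicit Defensive.

Import Order.TTheory GRing.Theory Num.Theory.
Import numFieldNormedType.Exports.

Local Open Scope classical_set_scope.
Local Open Scope ring_scope.

(** The library norm on matrices is the sup norm: it only provides the topology
    used for derivatives.  All lengths are measured with [enorm]. *)
Section Euclidean.
Variables (R : realType) (d : nat).

Definition dot (u v : 'cV[R]_d) : R := \sum_i u i 0 * v i 0.

Definition enorm (u : 'cV[R]_d) : R := Num.sqrt (dot u u).

Definition orthonormal (n : nat) (w : 'I_n -> 'cV[R]_d) : Prop :=
  forall i j, dot (w i) (w j) = (i == j)%:R.

Definition partial (i : 'I_d) (f : 'cV[R]_d -> R) : 'cV[R]_d -> R :=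
  'D_(delta_mx i 0) f.

Definition smooth (f : 'cV[R]_d -> R) : Prop :=
  forall (s : seq 'I_d) (x : 'cV[R]_d), differentiable (foldr partial f s) x.

Definition egrad (f : 'cV[R]_d -> R) (x : 'cV[R]_d) : 'cV[R]_d :=
  \col_i partial i f x.

(** [I - 2 \sum_i w_i w_i^T]. *)
Definition reflection (k : nat) (w : 'I_k -> 'cV[R]_d) : 'M[R]_d :=
  1%:M - 2 *: \sum_i (w i *m (w i)^T).

Definition curve_length (g : R -> 'cV[R]_d) : \bar R :=
  \int[@lebesgue_measure R]_(t in `[0, 1]) (enorm (derive1 g t))%:E.

End Euclidean.

Section Submanifold.
Variables (R : realType) (d m : nat) (c : 'I_m -> 'cV[R]_d -> R).

Definition manifold : set 'cV[R]_d := [set x | forall i, c i x = 0].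

(** Its rows are the transposed gradients of the constraints. *)
Definition constraint_jac (x : 'cV[R]_d) : 'M[R]_(m, d) :=
  \matrix_(j, i) egrad (c j) x i 0.

Definition independent_constraints : Prop :=
  forall x, manifold x -> row_free (constraint_jac x).

Definition tangent (x : 'cV[R]_d) : set 'cV[R]_d :=
  [set v | constraint_jac x *m v = 0].

(** Orthogonal projection onto [tangent x] where the constraints are
    independent, i.e. on the manifold and in a neighbourhood of it. *)
Definition tproj (x : 'cV[R]_d) : 'M[R]_d :=
  let J := constraint_jac x in 1%:M - J^T *m invmx (J *m J^T) *m J.

(** Extended-real valued: [+oo] between points of different components.
    A C^1 curve on [0, 1] extends to one on the line, so asking for
    differentiability on the whole line loses no curve. *)
Definition geodist (x y : 'cV[R]_d) : \bar R :=
  ereal_inf [set curve_length g | g in [set g : R -> 'cV[R]_d |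
    [/\ forall t, derivable g t 1, continuous (derive1 g),
        forall t, t \in `[0, 1] -> manifold (g t), g 0 = x & g 1 = y]]].

(** The Levi-Civita derivative of a tangent field along a curve is the tangential
    part of its ordinary derivative, the metric being the induced one. *)
Definition parallel_along (g V : R -> 'cV[R]_d) : Prop :=
  forall t, [/\ tangent (g t) (V t), derivable V t 1
              & tproj (g t) *m derive1 V t = 0].

(** Geodesics are taken on the whole line: the manifold is closed in R^d, hence
    geodesically complete. *)
Definition geodesic (g : R -> 'cV[R]_d) : Prop :=
  [/\ forall t, manifold (g t), forall t, derivable g t 1
    & parallel_along g (derive1 g)].

Definition geodesic_from (x v : 'cV[R]_d) (g : R -> 'cV[R]_d) : Prop :=
  [/\ geodesic g, g 0 = x & derive1 g 0 = v].

Definition mexp (x v : 'cV[R]_d) : 'cV[R]_d :=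
  xget 0 [set y | exists2 g, geodesic_from x v g & g 1 = y].

(** [v] is the initial velocity of a length-minimizing geodesic from [x] to [y]
    parametrized by [0, 1]. *)
Definition short_velocity (x y : 'cV[R]_d) : set 'cV[R]_d :=
  [set v | (exists2 g, geodesic_from x v g & g 1 = y)
           /\ (enorm v)%:E = geodist x y].

(** [exp_x^-1] is defined at [y] when there is a unique short geodesic from [x]
    to [y]; below the injectivity radius it is the inverse of [exp_x] on a ball. *)
Definition mlog_defined (x y : 'cV[R]_d) : Prop :=
  exists! v, short_velocity x y v.

Definition mlog (x y : 'cV[R]_d) : 'cV[R]_d := xget 0 (short_velocity x y).

(** Parallel transport of [u] from [x] to [y] along the short geodesic. *)
Definition ptransport (x y u : 'cV[R]_d) : 'cV[R]_d :=
  xget 0 [set w | exists g V : R -> 'cV[R]_d,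
    [/\ geodesic_from x (mlog x y) g, g 1 = y, parallel_along g V,
        V 0 = u & V 1 = w]].

(** Operator norm of a matrix restricted to [T_x (+) T_x]. *)
Definition tangent2_opnorm (x : 'cV[R]_d) (B : 'M[R]_(d + d)) : R :=
  sup [set enorm (B *m z) | z in [set z | [/\ tangent x (usubmx z),
                                tangent x (dsubmx z) & enorm z <= 1]]].

Section Objective.
Variable f : 'cV[R]_d -> R.

Definition rgrad (x : 'cV[R]_d) : 'cV[R]_d := tproj x *m egrad f x.

(** On [tangent x] this is the covariant derivative [v |-> P_x (D (grad f)(x)[v])],
    where [grad f] is extended off the manifold by the formula of [rgrad];
    the right factor makes the matrix vanish on the normal space. *)
Definition rhess (x : 'cV[R]_d) : 'M[R]_d :=
  tproj x *m (\matrix_(i, j) partial j (fun y => rgrad y i 0) x) *m tproj x.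

(** [lam] lists in nondecreasing order, with multiplicity, the eigenvalues of
    [rhess x] on the [(d - m)]-dimensional space [tangent x], and [w] is an
    orthonormal basis of corresponding eigenvectors. *)
Definition hess_eigensystem (x : 'cV[R]_d)
    (lam : 'I_(d - m) -> R) (w : 'I_(d - m) -> 'cV[R]_d) : Prop :=
  [/\ forall i j : 'I_(d - m), (i <= j)%N -> lam i <= lam j,
      orthonormal w, forall i, tangent x (w i)
    & forall i, rhess x *m w i = lam i *: w i].

Definition hess_eigenvalues (x : 'cV[R]_d) (lam : 'I_(d - m) -> R) : Prop :=
  exists w, hess_eigensystem x lam w.

(** [v] are orthonormal eigenvectors for the [k] smallest eigenvalues. *)
Definition smallest_eigenvectors (k : nat) (x : 'cV[R]_d)
    (v : 'I_k -> 'cV[R]_d) : Prop :=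
  exists lam w, hess_eigensystem x lam w /\
    forall (i : 'I_k) (j : 'I_(d - m)), i = j :> nat -> v i = w j.

Definition negative_eigenvectors (k : nat) (x : 'cV[R]_d)
    (v : 'I_k -> 'cV[R]_d) : Prop :=
  orthonormal v /\ forall i, tangent x (v i) /\
    exists2 l : R, l < 0 & rhess x *m v i = l *: v i.

Definition index_saddle (k : nat) (x : 'cV[R]_d) : Prop :=
  [/\ manifold x, rgrad x = 0
    & exists2 lam, hess_eigenvalues x lam & #|[set i | lam i < 0]%SET| = k].

(** [-L <= lam_1 <= .. <= lam_k <= -mu < 0 < mu <= lam_(k+1) <= .. <= L];
    the indices of [lam] start at 0. *)
Definition spectral_gap (k : nat) (L mu : R) (x : 'cV[R]_d) : Prop :=
  exists2 lam, hess_eigenvalues x lam &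
    forall i : 'I_(d - m),
      if (i < k)%N then - L <= lam i <= - mu else mu <= lam i <= L.

Definition momentum_step (k : nat) (dt gam : R) (x r : 'cV[R]_d)
    (v : 'I_k -> 'cV[R]_d) : 'cV[R]_d :=
  - dt *: (reflection v *m rgrad x) + gam *: r.

Definition momentum_saddle_dynamics (k : nat) (dt gam : R)
    (x r : nat -> 'cV[R]_d) (v : nat -> 'I_k -> 'cV[R]_d) : Prop :=
  [/\ manifold (x 0%N), r 0%N = 0 &
      forall n, let rbar := momentum_step dt gam (x n) (r n) (v n) in
        [/\ smallest_eigenvectors (x n) (v n),
            x n.+1 = mexp (x n) rbar
          & r n.+1 = ptransport (x n) (x n.+1) rbar]].

(** The matrix [A] of the linearized iteration, acting on [T_xs (+) T_xs]. *)
Definition linearization (k : nat) (dt gam : R) (xs : 'cV[R]_d)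
    (vs : 'I_k -> 'cV[R]_d) : 'M[R]_(d + d) :=
  let S := dt *: (reflection vs *m rhess xs) in
  block_mx (1%:M - S) gam%:M (- S) gam%:M.

End Objective.

Definition coords_defined (xs x : 'cV[R]_d) : Prop :=
  manifold x /\ mlog_defined xs x.

End Submanifold.

(* Main.v *)
Require Import Defs.
From HB Require Import structures.
From mathcomp Require Import all_boot all_order all_algebra.
From mathcomp Require Import all_classical all_reals all_analysis.
From mathcomp Require Import ring lra.
Import Order.TTheory GRing.Theory Num.Theory.
Import numFieldNormedType.Exports.
Local Open Scope classical_set_scope.
Local Open Scope ring_scope.

(** Write z_n for the pair (zeta_n, rho_n), s = sqrt kappa and
    q = 1 - 1 / (1 + s), so that q (1 - q) = s / (1 + s)^2.

    In local coordinates the iteration is a linear map A plus a remainder of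
    quadratic size.  Duhamel's formula z_n = A^n z_0 + \sum_(j < n) A^(n-1-j) res_j
    together with |A^i| <= C0 q^i gives
      |z_n| <= C0 q^n |z_0| + \sum_(j < n) C0 q^(n-1-j) C |z_j|^2.
    If |z_j| <= Ch q^j |z_0| for all j < n, the sum is at most
      C0 C Ch^2 |z_0|^2 q^(n-1) \sum_j q^j <= C0 C Ch^2 |z_0|^2 q^(n-1) / (1 - q),
    and since C Ch^2 |z_0| <= q (1 - q) this is at most C0 q^n |z_0|.  Hence
    |z_n| <= 2 C0 q^n |z_0| <= Ch q^n |z_0|, and the bound propagates; the
    condition Ch |z_0| <= rstar keeps every iterate in the region where the
    linearization is valid.  This induction is
    [quadratic_perturbation_bootstrap], fed by [enorm_discrete_Duhamel].

    The geometry enters in three places.  The powers of A are controlled only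
    on the double of the tangent space at xs, so z_0 and all remainders must
    lie there: logarithms and transported vectors are tangent
    ([mlog_tangent], [ptransport_tangent]) and A preserves tangency
    ([tangent2_linearization]).  The operator norm is a supremum, which bounds
    its members because a matrix is a bounded operator
    ([le_tangent2_opnorm]).  Finally the hypothesis bounds zeta_0 alone, which
    suffices because rho_0, the parallel transport of r_0 = 0, vanishes
    ([ptransport0]). *)

(** * Euclidean inner product and norm *)

Lemma dotE {R : realType} {d : nat} (u v : 'cV[R]_d) : dot u v = (u^T *m v) 0 0.
Proof. by rewrite mxE; apply: eq_bigr => i _; rewrite mxE. Qed.

Lemma dotC {R : realType} {d : nat} (u v : 'cV[R]_d) : dot u v = dot v u.
Proof. by apply: eq_bigr => i _; rewrite mulrC. Qed.

Lemma dotDr {R : realType} {d : nat} (u v w : 'cV[R]_d) :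
  dot u (v + w) = dot u v + dot u w.
Proof. by rewrite !dotE mulmxDr mxE. Qed.

Lemma dotZr {R : realType} {d : nat} (a : R) (u v : 'cV[R]_d) :
  dot u (a *: v) = a * dot u v.
Proof. by rewrite !dotE -scalemxAr mxE. Qed.

Lemma dot_ge0 {R : realType} {d : nat} (u : 'cV[R]_d) : 0 <= dot u u.
Proof. by apply: sumr_ge0 => i _; rewrite -expr2 sqr_ge0. Qed.

Lemma dot_eq0 {R : realType} {d : nat} (u : 'cV[R]_d) : dot u u = 0 -> u = 0.
Proof.
move=> /eqP; rewrite psumr_eq0 => [/allP u0|i _]; last by rewrite -expr2 sqr_ge0.
apply/colP => i; rewrite mxE; apply/eqP.
by have := u0 i (mem_index_enum _); rewrite /= -expr2 sqrf_eq0.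
Qed.

Lemma dot_Cauchy_Schwarz {R : realType} {d : nat} (u v : 'cV[R]_d) :
  dot u v ^+ 2 <= dot u u * dot v v.
Proof.
have [/dot_eq0 ->|vn0] := eqVneq (dot v v) 0.
  by rewrite !dotE !mulmx0 !mxE expr0n mulr0.
have vgt0 : 0 < dot v v by rewrite lt_neqAle eq_sym vn0 dot_ge0.
(* w is (v.v) times the component of u orthogonal to v. *)
pose w := dot v v *: u + (- dot u v) *: v.
have : dot w w = dot v v * (dot u u * dot v v - dot u v ^+ 2).
  rewrite /w dotDr !dotZr ![dot (_ + _) _]dotC !dotDr !dotZr [dot v u]dotC.
  by ring.
have := dot_ge0 w => /[swap] ->.
by rewrite pmulr_rge0// subr_ge0.
Qed.

Lemma enorm_ge0 {R : realType} {d : nat} (u : 'cV[R]_d) : 0 <= enorm u.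
Proof. exact: sqrtr_ge0. Qed.

Lemma enorm_sqr {R : realType} {d : nat} (u : 'cV[R]_d) : enorm u ^+ 2 = dot u u.
Proof. by rewrite sqr_sqrtr ?dot_ge0. Qed.

Lemma enorm0 {R : realType} {d : nat} : enorm (0 : 'cV[R]_d) = 0.
Proof. by rewrite /enorm dotE mulmx0 mxE sqrtr0. Qed.

Lemma enorm_eq0 {R : realType} {d : nat} (u : 'cV[R]_d) : enorm u = 0 -> u = 0.
Proof. by move=> u0; apply: dot_eq0; rewrite -enorm_sqr u0 expr0n. Qed.

Lemma enormZ {R : realType} {d : nat} (a : R) (u : 'cV[R]_d) :
  enorm (a *: u) = `|a| * enorm u.
Proof.
by rewrite /enorm dotZr dotC dotZr mulrA -expr2 sqrtrM ?sqr_ge0// sqrtr_sqr.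
Qed.

Lemma ler_enormD {R : realType} {d : nat} (u v : 'cV[R]_d) :
  enorm (u + v) <= enorm u + enorm v.
Proof.
rewrite -(@ler_pXn2r _ 2) ?nnegrE ?addr_ge0 ?enorm_ge0//.
rewrite sqrrD !enorm_sqr dotDr ![dot (_ + _) _]dotC !dotDr [dot v u]dotC.
suff : dot u v <= enorm u * enorm v by lra.
rewrite (le_trans (ler_norm _))// -sqrtr_sqr /enorm -sqrtrM ?dot_ge0//.
by rewrite ler_wsqrtr// dot_Cauchy_Schwarz.
Qed.

Lemma ler_enorm_sum {R : realType} {d n : nat} (F : 'I_n -> 'cV[R]_d) :
  enorm (\sum_i F i) <= \sum_i enorm (F i).
Proof.
elim/big_ind2: _ => [|u a v b ua vb|//]; first by rewrite enorm0.
by rewrite (le_trans (ler_enormD _ _))// lerD.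
Qed.

(** The Frobenius norm serves as K, by Cauchy-Schwarz on each row. *)
Lemma enorm_mulmx_bounded {R : realType} {p n : nat} (B : 'M[R]_(p, n)) :
  exists2 K : R, 0 <= K & forall z, enorm (B *m z) <= K * enorm z.
Proof.
pose F := \sum_i dot (row i B)^T (row i B)^T.
have F0 : 0 <= F by apply: sumr_ge0 => i _; exact: dot_ge0.
exists (Num.sqrt F); first exact: sqrtr_ge0.
move=> z; rewrite /enorm -sqrtrM// ler_wsqrtr// /F mulr_suml.
apply: ler_sum => i _; rewrite -expr2.
have -> : (B *m z) i 0 = dot (row i B)^T z.
  by rewrite mxE; apply: eq_bigr => j _; rewrite !mxE.
exact: dot_Cauchy_Schwarz.
Qed.

Lemma dot_col_mx {R : realType} {d e : nat} (u : 'cV[R]_d) (v : 'cV[R]_e) :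
  dot (col_mx u v) (col_mx u v) = dot u u + dot v v.
Proof. by rewrite !dotE tr_col_mx mul_row_col mxE. Qed.

Lemma enorm_col_mxl {R : realType} {d e : nat} (u : 'cV[R]_d) (v : 'cV[R]_e) :
  enorm u <= enorm (col_mx u v).
Proof. by rewrite ler_wsqrtr// dot_col_mx lerDl dot_ge0. Qed.

(** * Tangent spaces and the linearized iteration *)

Lemma tangent0 {R : realType} {d m : nat} (c : 'I_m -> 'cV[R]_d -> R)
    (x : 'cV[R]_d) : tangent c x 0.
Proof. exact: mulmx0. Qed.

Lemma tangentD {R : realType} {d m : nat} (c : 'I_m -> 'cV[R]_d -> R)
    (x u v : 'cV[R]_d) :
  tangent c x u -> tangent c x v -> tangent c x (u + v).
Proof. by rewrite /tangent/= mulmxDr => -> ->; rewrite addr0. Qed.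

Lemma tangentZ {R : realType} {d m : nat} (c : 'I_m -> 'cV[R]_d -> R)
    (a : R) (x u : 'cV[R]_d) : tangent c x u -> tangent c x (a *: u).
Proof. by rewrite /tangent/= -scalemxAr => ->; rewrite scaler0. Qed.

Lemma tproj_tangent {R : realType} {d m : nat} (c : 'I_m -> 'cV[R]_d -> R)
    (x u : 'cV[R]_d) : tangent c x u -> tproj c x *m u = u.
Proof.
move=> xu; rewrite /tproj/=.
by rewrite mulmxBl mul1mx -(mulmxA _ (constraint_jac c x) u) xu mulmx0 subr0.
Qed.

Lemma tr_tproj {R : realType} {d m : nat} (c : 'I_m -> 'cV[R]_d -> R)
    (x : 'cV[R]_d) : (tproj c x)^T = tproj c x.
Proof.
by rewrite /tproj linearB/= trmx1 !trmx_mul trmxK trmx_inv trmx_mul trmxK mulmxA.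
Qed.

(** If v J J^T = 0 then |v J|^2 = v J J^T v^T = 0: over the reals the Gram matrix
    has no more kernel than J. *)
Lemma row_free_gram_unit {R : realType} {p n : nat} (J : 'M[R]_(p, n)) :
  row_free J -> J *m J^T \in unitmx.
Proof.
move=> Jfree; rewrite -row_free_unit; apply: inj_row_free => v vJJ.
suff vJ0 : v *m J = 0 by apply/eqP; rewrite -(mulmx_free_eq0 _ Jfree) vJ0.
apply: trmx_inj; rewrite trmx0; apply: dot_eq0.
by rewrite dotE trmxK trmx_mul mulmxA -[v *m J *m _]mulmxA vJJ mul0mx mxE.
Qed.

Lemma tangent_tproj {R : realType} {d m : nat} (c : 'I_m -> 'cV[R]_d -> R)
    (x u : 'cV[R]_d) :
  row_free (constraint_jac c x) -> tangent c x (tproj c x *m u).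
Proof.
move=> /row_free_gram_unit Ju; rewrite /tangent/= mulmxA /tproj.
by rewrite mulmxBr mulmx1 2!mulmxA mulmxV// mul1mx subrr mul0mx.
Qed.

Definition tangent2 {R : realType} {d m : nat} (c : 'I_m -> 'cV[R]_d -> R)
    (x : 'cV[R]_d) : set 'cV[R]_(d + d) :=
  [set z | tangent c x (usubmx z) /\ tangent c x (dsubmx z)].

Lemma tangent2D {R : realType} {d m : nat} (c : 'I_m -> 'cV[R]_d -> R)
    (x : 'cV[R]_d) z w : tangent2 c x z -> tangent2 c x w -> tangent2 c x (z + w).
Proof. by move=> [zu zd] [wu wd]; split; rewrite linearD; exact: tangentD. Qed.

Lemma tangent2Z {R : realType} {d m : nat} (c : 'I_m -> 'cV[R]_d -> R)
    (a : R) (x : 'cV[R]_d) z : tangent2 c x z -> tangent2 c x (a *: z).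
Proof. by move=> [zu zd]; split; rewrite linearZ; exact: tangentZ. Qed.

(** The supremum of an unbounded set is a junk value, so the boundedness of
    z |-> B z is what makes the operator norm meaningful; the rest is scaling z to
    the unit sphere. *)
Lemma le_tangent2_opnorm {R : realType} {d m : nat} (c : 'I_m -> 'cV[R]_d -> R)
    (x : 'cV[R]_d) (B : 'M[R]_(d + d)) z : tangent2 c x z ->
  enorm (B *m z) <= tangent2_opnorm c x B * enorm z.
Proof.
move=> [zu zd].
have [/enorm_eq0 ->|zn0] := eqVneq (enorm z) 0; first by rewrite mulmx0 enorm0 mulr0.
have z0 : 0 < enorm z by rewrite lt_neqAle eq_sym zn0 enorm_ge0.
have [K K0 BK] := enorm_mulmx_bounded B.
rewrite -ler_pdivrMr//; apply: ub_le_sup.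
  exists K => _ [w [_ _ w1] <-]; rewrite (le_trans (BK w))//.
  by rewrite -[leRHS]mulr1 ler_wpM2l.
exists ((enorm z)^-1 *: z); last first.
  by rewrite -scalemxAr enormZ gtr0_norm ?invr_gt0// mulrC.
split; rewrite ?linearZ/=; [exact: tangentZ|exact: tangentZ|].
by rewrite enormZ gtr0_norm ?invr_gt0// mulVf.
Qed.

Lemma tangent_reflection {R : realType} {d m : nat} (c : 'I_m -> 'cV[R]_d -> R)
    {k} (x : 'cV[R]_d) (w : 'I_k -> 'cV[R]_d) u :
  (forall i, tangent c x (w i)) -> tangent c x u ->
  tangent c x (reflection w *m u).
Proof.
move=> wx ux; rewrite /reflection mulmxBl mul1mx -scaleN1r.
apply: tangentD => //; apply/tangentZ; rewrite -scalemxAl; apply: tangentZ.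
rewrite mulmx_suml; elim/big_ind: _ => [|a b|i _].
- exact: tangent0.
- exact: tangentD.
- by rewrite /tangent/= !mulmxA wx !mul0mx.
Qed.

(** The Hessian takes its values in the tangent space, and the reflection
    only adds multiples of the tangent vectors w_i. *)
Lemma tangent2_linearization {R : realType} {d m : nat} (c : 'I_m -> 'cV[R]_d -> R)
    {k} (f : 'cV[R]_d -> R) (dt gam : R) (x : 'cV[R]_d)
    (w : 'I_k -> 'cV[R]_d) z :
  row_free (constraint_jac c x) -> (forall i, tangent c x (w i)) ->
  tangent2 c x z -> tangent2 c x (linearization c f dt gam x w *m z).
Proof.
move=> Jx wx; rewrite -[z]vsubmxK; move: (usubmx z) (dsubmx z) => u v.
rewrite /tangent2/= col_mxKu col_mxKd => -[xu xv].
have xS : tangent c x ((dt *: (reflection w *m rhess c f x)) *m u).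
  rewrite -scalemxAl -mulmxA; apply/tangentZ/tangent_reflection => //.
  by rewrite /rhess -!mulmxA; apply: tangent_tproj.
rewrite /linearization mul_block_col col_mxKu col_mxKd.
rewrite !mul_scalar_mx mulmxBl mulNmx mul1mx -scaleN1r.
by split; do !apply: tangentD => //; exact: tangentZ.
Qed.

(** * Logarithm and parallel transport *)

Lemma mlog_tangent {R : realType} {d m : nat} (c : 'I_m -> 'cV[R]_d -> R)
    (x y : 'cV[R]_d) : mlog_defined c x y -> tangent c x (mlog c x y).
Proof.
move=> [w [yw _]]; rewrite /mlog.
have [[g [[_ _ gpar] <- <-] _] _] :
    short_velocity c x y (xget 0 (short_velocity c x y)).
  exact: xgetI yw.
by have [] := gpar 0.
Qed.

(** Unconditional: where no transport exists, the default value 0 is tangent. *)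
Lemma ptransport_tangent {R : realType} {d m : nat} (c : 'I_m -> 'cV[R]_d -> R)
    (x y u : 'cV[R]_d) : tangent c y (ptransport c x y u).
Proof.
rewrite /ptransport; case: xgetP => [w _ [g [V [_ <- gV _ <-]]]|_].
  by have [] := gV 1.
exact: tangent0.
Qed.

(** Parallel fields have constant length: V being tangent and P the symmetric
    tangential projection, <V, V'> = <P V, V'> = <V, P V'> = 0. *)
Lemma parallel_along_enorm {R : realType} {d m : nat} (c : 'I_m -> 'cV[R]_d -> R)
    (g V : R -> 'cV[R]_d) s t :
  parallel_along c g V -> enorm (V s) = enorm (V t).
Proof.
move=> gV; rewrite /enorm; congr Num.sqrt.
apply: (@is_derive_0_is_cst R (fun t => dot (V t) (V t))) => {}t.
have [Vtan Vder Vpar] := gV t.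
have VV' : dot (V t) (derive1 V t) = 0.
  rewrite dotE -{1}(tproj_tangent _ _ _ Vtan) trmx_mul tr_tproj -mulmxA Vpar.
  by rewrite mulmx0 mxE.
have Vi i : is_derive t 1 (fun t => V t i 0) (derive1 V t i 0).
  have /derivable_mxP/(_ i 0) Vi := Vder.
  by apply: DeriveDef => //; rewrite derive1E derive_mx// mxE.
have -> : (fun t => dot (V t) (V t)) =
    \sum_i ((fun t => V t i 0) * (fun t => V t i 0)).
  by apply/funext => y; rewrite fct_sumE.
have -> : 0 = \sum_i (V t i 0 *: derive1 V t i 0 + V t i 0 *: derive1 V t i 0).
  by rewrite big_split/= -[X in X + _]/(dot _ _) -[X in _ + X]/(dot _ _) VV' addr0.
by apply: is_derive_sum => i; exact: (is_deriveM (Vi i) (Vi i)).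
Qed.

Lemma ptransport0 {R : realType} {d m : nat} (c : 'I_m -> 'cV[R]_d -> R)
    (x y : 'cV[R]_d) : ptransport c x y 0 = 0.
Proof.
rewrite /ptransport; case: xgetP => [w _ [g [V [_ _ gV V0 <-]]]|//].
by apply: enorm_eq0; rewrite (parallel_along_enorm c g V 1 0 gV) V0 enorm0.
Qed.

(** * Quadratic perturbations of a linear iteration *)

(** With the defect z_(j+1) - A z_j in the role of the source term, the formula is
    an identity for every sequence. *)
Lemma discrete_Duhamel {R : realType} {N : nat} (A : 'M[R]_N) (z : nat -> 'cV[R]_N) n :
  z n = A ^+ n *m z 0%N + \sum_(j < n) A ^+ (n - j.+1) *m (z j.+1 - A *m z j).
Proof.
elim: n => [|n IH]; first by rewrite big_ord0 addr0 expr0 mul1mx.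
have AX p : A ^+ p.+1 = A *m A ^+ p by rewrite exprS.
have -> : z n.+1 = A *m z n + (z n.+1 - A *m z n) by rewrite addrC subrK.
rewrite big_ord_recr/= subnn expr0 mul1mx [RHS]addrA; congr (_ + _).
rewrite {1}IH mulmxDr mulmxA -AX; congr (_ + _).
rewrite mulmx_sumr; apply: eq_bigr => j _.
by rewrite mulmxA -AX -subSn.
Qed.

(** The powers of A are assumed to decay on T only, so the initial value and
    every defect have to be in T; in the application T is an invariant subspace. *)
Lemma enorm_discrete_Duhamel {R : realType} {N : nat} (A : 'M[R]_N)
    (T : set 'cV[R]_N) (C0 q : R) (z : nat -> 'cV[R]_N) n :
  T (z 0%N) -> (forall i, (i < n)%N -> T (z i.+1 - A *m z i)) ->
  (forall i w, T w -> enorm (A ^+ i *m w) <= C0 * q ^+ i * enorm w) ->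
  enorm (z n) <= C0 * q ^+ n * enorm (z 0%N) +
    \sum_(j < n) C0 * q ^+ (n - j.+1) * enorm (z j.+1 - A *m z j).
Proof.
move=> z0T rT AT; rewrite {1}(discrete_Duhamel A z n).
apply: (le_trans (ler_enormD _ _)); apply: lerD; first exact: AT.
apply: (le_trans (ler_enorm_sum _)); apply: ler_sum => j _.
by apply: AT; exact: rT.
Qed.

Lemma sum_geometric_le {R : realType} (q : R) n : 0 <= q -> q < 1 ->
  (1 - q) * \sum_(i < n) q ^+ i <= 1.
Proof.
move=> q0 q1; rewrite -opprB mulNr -subrX1 opprB lerBlDr lerDl.
exact: exprn_ge0.
Qed.

(** E_n is the size of the n-th iterate, D_n that of the defect of the n-th step,
    and P n says that the n-th iterate stays in the domain.  The contribution of
    the defects is at most C0 q^n E_0, as much as that of the linear part, whence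
    the factor 2.  The Duhamel bound is asked for only while the iterates stay in
    the domain, because tangency of the coordinates is known only there. *)
Lemma quadratic_perturbation_bootstrap {R : realType} (C0 C Ch q rad : R)
    (E D : nat -> R) (P : nat -> Prop) :
  0 < q -> q < 1 -> 1 <= C0 -> 0 <= C -> 2 * C0 <= Ch -> 0 < rad ->
  (forall n, 0 <= E n) ->
  C * Ch ^+ 2 * E 0%N <= q * (1 - q) -> Ch * E 0%N <= rad ->
  P 0%N ->
  (forall n, P n -> E n < rad -> P n.+1 /\ D n <= C * E n ^+ 2) ->
  (forall n, (forall j, (j <= n)%N -> P j) -> E n <= C0 * q ^+ n * E 0%N +
    \sum_(j < n) C0 * q ^+ (n - j.+1) * D j) ->
  forall n, P n /\ E n <= Ch * q ^+ n * E 0%N.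
Proof.
move=> q0 q1 hC0 hC hCh rad0 E0 small hrad P0 step duh.
have E00 := E0 0%N.
have qn n : 0 <= q ^+ n by rewrite exprn_ge0// ltW.
(* For n = 0 strictness comes from Ch >= 2, for n > 0 from q^n < 1. *)
have below n : E n <= Ch * q ^+ n * E 0%N -> E n < rad.
  case: n => [_|n En]; first by nra.
  apply: (le_lt_trans En); rewrite mulrAC.
  have : q ^+ n.+1 < 1 by rewrite exprn_ilt1// ltW.
  by have := qn n.+1; nra.
suff all n : forall j, (j <= n)%N -> P j /\ E j <= Ch * q ^+ j * E 0%N.
  by move=> n; exact: (all n n).
elim: n => [j|n IH j].
  by rewrite leqn0 => /eqP ->; split=> //; rewrite expr0 mulr1; nra.
rewrite leq_eqVlt => /predU1P[->{j}|/IH//].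
have [Pn En] := IH n (leqnn n).
have [PSn _] := step n Pn (below n En).
split=> //.
have Dj (j : 'I_n.+1) : C0 * q ^+ (n.+1 - j.+1) * D j <=
    C0 * (C * Ch ^+ 2 * E 0%N) * E 0%N * q ^+ n * q ^+ j.
  have [Pj Ej] := IH j (ltn_ord j).
  have [_ Dj] := step j Pj (below j Ej).
  have Ej2 : E j ^+ 2 <= (Ch * q ^+ j * E 0%N) ^+ 2.
    by rewrite ler_pXn2r ?nnegrE// (le_trans _ Ej).
  have -> : q ^+ n = q ^+ (n - j) * q ^+ j.
    by rewrite -exprD subnK// -ltnS.
  rewrite subSS.
  have -> : C0 * (C * Ch ^+ 2 * E 0%N) * E 0%N * (q ^+ (n - j) * q ^+ j) * q ^+ j
     = C0 * q ^+ (n - j) * (C * (Ch * q ^+ j * E 0%N) ^+ 2) by ring.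
  apply: ler_wpM2l; first by rewrite mulr_ge0//; lra.
  by rewrite (le_trans Dj)// ler_wpM2l.
have Ple j : (j <= n.+1)%N -> P j.
  by rewrite leq_eqVlt => /predU1P[->//|]; rewrite ltnS => /IH[].
apply: (le_trans (duh n.+1 Ple)).
have sumD : \sum_(j < n.+1) C0 * q ^+ (n.+1 - j.+1) * D j <= C0 * q ^+ n.+1 * E 0%N.
  apply: (le_trans (ler_sum _ (fun j _ => Dj j))); rewrite -mulr_sumr.
  have S1 := sum_geometric_le q n.+1 (ltW q0) q1.
  have S0 : 0 <= \sum_(j < n.+1) q ^+ j by apply: sumr_ge0.
  apply: (@le_trans _ _ (C0 * (q * (1 - q)) * E 0%N * q ^+ n * \sum_(j < n.+1) q ^+ j)).
    do 3 (apply: ler_wpM2r => //); apply: ler_wpM2l => //; lra.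
  have -> : C0 * (q * (1 - q)) * E 0%N * q ^+ n * (\sum_(j < n.+1) q ^+ j) =
      C0 * q ^+ n.+1 * E 0%N * ((1 - q) * \sum_(j < n.+1) q ^+ j).
    by rewrite exprS; ring.
  rewrite -[leRHS]mulr1 ler_wpM2l// !mulr_ge0//; lra.
have : 0 <= q ^+ n.+1 * E 0%N by rewrite mulr_ge0.
nra.
Qed.

(** * Local linear convergence *)

Theorem proposition4p12 (R : realType) (d m k : nat)
  (f : 'cV[R]_d -> R) (c : 'I_m -> 'cV[R]_d -> R)
  (hf : smooth f) (hc : forall i, smooth (c i))
  (hind : independent_constraints c)
  (hk : (1 <= k <= d - m - 1)%N)
  (xs : 'cV[R]_d) (hxs : index_saddle c f k xs)
  (delta L mu : R) (hdelta : 0 < delta) (hmu : 0 < mu) (hL : mu < L)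
  (hspec : forall x, manifold c x -> (geodist c x xs < delta%:E)%E ->
    spectral_gap c f k L mu x)
  (kappa dt gam : R)
  (hkappa : kappa = L / mu)
  (hdt : dt = 4 / (Num.sqrt L + Num.sqrt mu) ^+ 2)
  (hgam : gam = ((Num.sqrt L - Num.sqrt mu) / (Num.sqrt L + Num.sqrt mu)) ^+ 2)
  (vs : 'I_k -> 'cV[R]_d) (hvs : negative_eigenvectors c f xs vs)
  (x r : nat -> 'cV[R]_d) (v : nat -> 'I_k -> 'cV[R]_d)
  (hdyn : momentum_saddle_dynamics c f dt gam x r v)
  (zeta : nat -> 'cV[R]_d) (hzeta : forall n, zeta n = mlog c xs (x n))
  (rho : nat -> 'cV[R]_d) (hrho : forall n, rho n = ptransport c (x n) xs (r n))
  (C0 C rstar Ch : R) (hC0 : 1 <= C0) (hC : 0 < C) (hrstar : 0 < rstar)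
  (hpow : forall n : nat, (1 <= n)%N ->
    tangent2_opnorm c xs (linearization c f dt gam xs vs ^+ n)
      <= C0 * (1 - (1 + Num.sqrt kappa)^-1) ^+ n)
  (hstep : forall n : nat, coords_defined c xs (x n) ->
    enorm (col_mx (zeta n) (rho n)) < rstar ->
    coords_defined c xs (x n.+1) /\
    exists res : 'cV[R]_(d + d),
      col_mx (zeta n.+1) (rho n.+1)
        = linearization c f dt gam xs vs *m col_mx (zeta n) (rho n) + res /\
      enorm res <= C * (enorm (zeta n) ^+ 2 + enorm (rho n) ^+ 2))
  (hCh : 2 * C0 < Ch)
  (hx0 : coords_defined c xs (x 0%N))
  (hzeta0 : enorm (zeta 0%N) <=
    Num.min (Num.sqrt kappa / ((1 + Num.sqrt kappa) ^+ 2 * C * Ch ^+ 2))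
            (rstar / Ch)) :
  forall n : nat,
    coords_defined c xs (x n) /\
    enorm (zeta n) <= enorm (col_mx (zeta n) (rho n)) /\
    enorm (col_mx (zeta n) (rho n)) <=
      Ch * (1 - (1 + Num.sqrt kappa)^-1) ^+ n * enorm (col_mx (zeta 0%N) (rho 0%N)).
Proof.
have s0 : 0 < Num.sqrt kappa by rewrite sqrtr_gt0 hkappa divr_gt0// (lt_trans hmu).
set s := Num.sqrt kappa in s0 hpow hzeta0 *; set q := 1 - (1 + s)^-1 in hpow *.
have sV : (1 + s) * (1 + s)^-1 = 1 by rewrite mulfV// gt_eqF// addr_gt0.
have sV0 : 0 < (1 + s)^-1 by rewrite invr_gt0 addr_gt0.
have q0 : 0 < q by rewrite /q; nra.
have q1 : q < 1 by rewrite /q; lra.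
have Jxs : row_free (constraint_jac c xs) by apply: hind; case: hxs.
have vsT i : tangent c xs (vs i) by have [_ /(_ i)[]] := hvs.
set A := linearization c f dt gam xs vs in hpow hstep.
have AV w : tangent2 c xs w -> tangent2 c xs (A *m w).
  exact: tangent2_linearization.
have zT n : coords_defined c xs (x n) ->
    tangent2 c xs (col_mx (zeta n) (rho n)).
  move=> [_ xn]; split; rewrite ?col_mxKu ?col_mxKd.
    by rewrite hzeta; exact: mlog_tangent.
  by rewrite hrho; exact: ptransport_tangent.
(* The exponent 0 is outside the assumed decay, and is covered by C0 >= 1. *)
have powA i w : tangent2 c xs w -> enorm (A ^+ i *m w) <= C0 * q ^+ i * enorm w.
  move=> wT; case: i => [|i].
    by rewrite !expr0 mul1mx mulr1 ler_peMl ?enorm_ge0.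
  apply: (le_trans (le_tangent2_opnorm c xs (A ^+ i.+1) w wT)).
  by apply: ler_wpM2r; [exact: enorm_ge0|exact: hpow].
have rho0 : rho 0%N = 0 by rewrite hrho; case: hdyn => _ -> _; exact: ptransport0.
have E0 : enorm (col_mx (zeta 0%N) (rho 0%N)) = enorm (zeta 0%N).
  by rewrite rho0 /enorm dot_col_mx [dot 0 0]dotE mulmx0 mxE addr0.
pose D n := enorm (col_mx (zeta n.+1) (rho n.+1) - A *m col_mx (zeta n) (rho n)).
have Ch0 : 0 < Ch by lra.
(* As q = s / (1 + s), the first bound is the one with s / (1 + s)^2. *)
have [small near] : C * Ch ^+ 2 * enorm (zeta 0%N) <= q * (1 - q) /\
    Ch * enorm (zeta 0%N) <= rstar.
  move: hzeta0; rewrite le_min => /andP[].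
  rewrite !ler_pdivlMr//; last by rewrite !mulr_gt0 ?exprn_gt0 ?addr_gt0.
  rewrite [_ * Ch]mulrC => small ->; split=> //.
  rewrite -(ler_pM2r (exprn_gt0 2 (addr_gt0 ltr01 s0))).
  have -> : q * (1 - q) * (1 + s) ^+ 2 = s.
    have -> : q * (1 - q) * (1 + s) ^+ 2 =
      (1 + s - (1 + s) * (1 + s)^-1) * ((1 + s) * (1 + s)^-1) by rewrite /q; ring.
    by rewrite sV; ring.
  by apply: le_trans small; rewrite le_eqVlt; apply/orP; left; apply/eqP; ring.
have step n : coords_defined c xs (x n) ->
    enorm (col_mx (zeta n) (rho n)) < rstar ->
    coords_defined c xs (x n.+1) /\
    D n <= C * enorm (col_mx (zeta n) (rho n)) ^+ 2.
  move=> xn /(hstep n xn)[xn1 [res [zn1 hres]]]; split=> //.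
  by rewrite /D zn1 addrAC subrr add0r enorm_sqr dot_col_mx -!enorm_sqr.
have duhamel n : (forall j, (j <= n)%N -> coords_defined c xs (x j)) ->
    enorm (col_mx (zeta n) (rho n)) <=
    C0 * q ^+ n * enorm (col_mx (zeta 0%N) (rho 0%N)) +
    \sum_(j < n) C0 * q ^+ (n - j.+1) * D j.
  move=> xle.
  apply: (enorm_discrete_Duhamel A (tangent2 c xs) C0 q
    (fun n => col_mx (zeta n) (rho n))) => //; first exact: zT.
  move=> i ilt; rewrite -scaleN1r; apply: tangent2D; first exact: zT (xle _ ilt).
  by apply: tangent2Z; apply/AV/zT/xle/ltnW.
rewrite -E0 in small near.
move=> n; have [xn zn] := quadratic_perturbation_bootstrap C0 C Ch q rstar
  (fun n => enorm (col_mx (zeta n) (rho n))) D (fun n => coords_defined c xs (x n))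
  q0 q1 hC0 (ltW hC) (ltW hCh) hrstar (fun n => enorm_ge0 _) small near
  hx0 step duhamel n.
by split=> //; split=> //; exact: enorm_col_mxl.
Qed.
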